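(* Let $q$ be a complex number with $|q|<1$, and let $B_3(n) := n(n-1)(n-1/2)$ for integers $n\geq 1$. Then the following two identities hold: \[ \left(\sum_{n\geq1}\frac{nq^{2n}}{1+q^{2n}}\right)\left(\sum_{n\geq1}\frac{(2n-1)q^{2n-1}}{1-q^{4n-2}}\right)=\sum_{n\geq1}\frac{B_{3}(n)}{3}\,\frac{q^{2n-1}}{1-q^{4n-2}}, \] and \[ 6\sum_{n\geq1}\frac{q^{4n-2}}{(1-q^{2n-1})^{4}}+\sum_{n\geq1}\frac{q^{2n-1}}{(1-q^{2n-1})^{2}}=\sum_{n\geq1}\frac{n^{3}q^{n}}{1-q^{2n}}. \]
   Context: All sums run over positive integers $n$. *)

(* Defs.v *)
From Stdlib Require Export Reals.
From Coquelicot Require Export Coquelicot.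

Definition B3 (n : nat) : R := (INR n * (INR n - 1) * (INR n - 1 / 2))%R.

(* [is_sum f s]: the series of the [f n] over n >= 1 converges in C, to [s];
   [is_series] itself starts at index 0. *)
Definition is_sum (f : nat -> C) (s : C) : Prop :=
  is_series (K := C_AbsRing) (V := C_NormedModule) (fun k => f (S k)) s.

(* Main.v *)
Require Import Defs.
From Stdlib Require Import Reals Arith Lra Lia.
From Coquelicot Require Import Coquelicot.
Open Scope C_scope.

(** Write [h n = q^n / (1 - q^(2n))] and [g n = q^(2n) / (1 - q^(2n))].  With
    [q = exp (-t)] these are [csch (n t) / 2] and [(coth (n t) - 1) / 2], so [h]
    extends oddly to negative [n] and [g (-n) = -1 - g n].

    First identity.  Sum the double array
      [j s h(2j) (h(2j+s) + h(s-2j))],   [j >= 1], [s >= 1] odd,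
    in both orders.
    - For fixed [j], shifting [s] by [2j] in both halves turns the weight [s] into
      [p - 2j] and [p + 2j], and oddness of [h] folds the overlap back: the row
      is [2 j h(2j)] times [S2 = sum p h(p)] over odd [p].
    - For fixed [s], the subtraction formula
      [h x h y = h (y - x) (g x - g y)] gives
      [h(2j) (h(2j+s) + h(s-2j)) = h(s) (2 g(2j) - g(2j+s) - g(2j-s))], and the same
      folding for [g] leaves [s h(s) (2 G0 - G1 + (s^2-1)/8)], with
      [G0 = sum j g(2j)] and [G1 = sum p g(p)] over odd [p].  The constant [-1] in
      the reflection of [g] is what produces the quadratic term, hence [B3].
    Equating the two orders, [2 D S2 = (2 G0 - G1) S2 + 3 S3] with
    [D = sum j h(2j)].  Finally [S1] equals both [D - G0] (termwise) and [G1]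
    (splitting [sum n g(n)] by the parity of [n]), and [S1 S2 = S3] follows.  Both
    foldings are instances of [Cseries_reflect].

    Second identity.  Sum [n^3 (q^m)^n], [m] odd, in both orders: over [n] the closed
    form of [sum n^3 y^n] is [6 y^2/(1-y)^4 + y/(1-y)^2], and over [m] one has a
    geometric series.

    Both exchanges are justified by [Cseries_fubini], with a bound of product form
    [u i * v j], where both factors decay like a polynomial times [r^k] for some
    [r < 1]. *)

(** * Complex series *)

Notation Cseries := (@is_series C_AbsRing C_NormedModule).

Ltac push_INR :=
  repeat first [ rewrite plus_INR | rewrite mult_INR | rewrite S_INR
               | rewrite INR_0 | rewrite RtoC_plus | rewrite RtoC_mult ].

Lemma Cseries_ext (a b : nat -> C) (l : C) :
  (forall n, a n = b n) -> Cseries a l -> Cseries b l.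
Proof. apply is_series_ext. Qed.

Lemma Cseries_plus (a b : nat -> C) (la lb : C) :
  Cseries a la -> Cseries b lb -> Cseries (fun n => a n + b n) (la + lb).
Proof. apply (is_series_plus a b la lb). Qed.

Lemma Cseries_scal (c : C) (a : nat -> C) (l : C) :
  Cseries a l -> Cseries (fun n => c * a n) (c * l).
Proof. apply (is_series_scal c a l). Qed.

Lemma Cseries_minus (a b : nat -> C) (la lb : C) :
  Cseries a la -> Cseries b lb -> Cseries (fun n => a n - b n) (la - lb).
Proof. apply (is_series_minus a b la lb). Qed.

Lemma Cseries_unique (a : nat -> C) (l l' : C) :
  Cseries a l -> Cseries a l' -> l = l'.
Proof.
intros H H'.
exact (filterlim_locally_unique (V := C_NormedModule) _ _ _ H H').
Qed.

Lemma Cseries_shift (a : nat -> C) (l : C) :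
  Cseries a l -> Cseries (fun k => a (S k)) (l - a 0%nat).
Proof.
intros H. apply is_series_incr_1.
match goal with |- is_series _ ?x => replace x with l; [exact H|] end.
change (l = l - a 0%nat + a 0%nat). ring.
Qed.

Lemma Cseries_unshift (a : nat -> C) (l : C) :
  Cseries (fun k => a (S k)) l -> Cseries a (a 0%nat + l).
Proof.
intros H. apply is_series_decr_1.
match goal with |- is_series _ ?x => replace x with l; [exact H|] end.
change (l = a 0%nat + l + - a 0%nat). ring.
Qed.

(** Unlike [sum_n], which stops at its last index, this allows an empty sum. *)
Fixpoint psum (a : nat -> C) (m : nat) : C :=
  match m with
  | O => 0
  | S m' => psum a m' + a m'
  end.

Lemma psum_S (a : nat -> C) (m : nat) : psum a (S m) = psum a m + a m.
Proof. reflexivity. Qed.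

Lemma psum_ext (a b : nat -> C) (m : nat) :
  (forall k, (k < m)%nat -> a k = b k) -> psum a m = psum b m.
Proof.
induction m as [|m IH]; intros H; simpl; [reflexivity|].
rewrite IH by (intros k Hk; apply H; lia). now rewrite H by lia.
Qed.

Lemma psum_head (a : nat -> C) (m : nat) :
  psum a (S m) = a 0%nat + psum (fun k => a (S k)) m.
Proof.
induction m as [|m IH]; [simpl; ring|].
change (psum a (S m) + a (S m)
        = a 0%nat + (psum (fun k => a (S k)) m + a (S m))).
rewrite IH. ring.
Qed.

Lemma psum_rev (a : nat -> C) (m : nat) :
  psum (fun k => a (m - 1 - k)%nat) m = psum a m.
Proof.
induction m as [|m IH]; [reflexivity|].
rewrite psum_head. simpl psum at 2. rewrite <- IH, Cplus_comm.
f_equal; [apply psum_ext; intros k Hk|]; f_equal; lia.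
Qed.

Lemma Cseries_drop (a : nat -> C) (l : C) (m : nat) :
  Cseries a l -> Cseries (fun k => a (m + k)%nat) (l - psum a m).
Proof.
intros H. induction m as [|m IH].
- simpl. replace (l - 0) with l by ring. exact H.
- apply Cseries_shift in IH. cbv beta in IH. simpl psum.
  replace (l - (psum a m + a m)) with (l - psum a m - a (m + 0)%nat)
    by (rewrite Nat.add_0_r; ring).
  revert IH. apply Cseries_ext. intros k. f_equal. lia.
Qed.

Lemma Cseries_undrop (a : nat -> C) (l : C) (m : nat) :
  Cseries (fun k => a (m + k)%nat) l -> Cseries a (psum a m + l).
Proof.
revert l. induction m as [|m IH]; intros l H.
- simpl. replace (0 + l) with l by ring. exact H.
- simpl psum. replace (psum a m + a m + l) with (psum a m + (a (m + 0)%nat + l))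
    by (rewrite Nat.add_0_r; ring).
  apply IH, (Cseries_unshift (fun k => a (m + k)%nat)).
  revert H. apply Cseries_ext. intros k. f_equal. lia.
Qed.

(** * Domination and exchange of summations *)

Lemma Cseries_Cmod_le (a : nat -> C) (l : C) (b : nat -> R) (L : R) :
  Cseries a l -> is_series b L -> (forall n, Cmod (a n) <= b n)%R ->
  (Cmod l <= L)%R.
Proof.
intros Ha Hb Hab.
assert (Hn : filterlim (fun n => norm (sum_n a n)) eventually (locally (norm l))).
{ apply (filterlim_comp _ _ _ _ norm _ (locally l)); [exact Ha|].
  apply (filterlim_norm (V := C_NormedModule)). }
change (Rbar_le (@norm C_AbsRing C_NormedModule l) L).
apply (is_lim_seq_le (fun n => norm (sum_n a n)) (sum_n b) (norm l) L);
  [|exact Hn|exact Hb].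
intros n. unfold sum_n.
eapply Rle_trans; [apply (norm_sum_n_m (V := C_NormedModule))|]. apply sum_n_m_le.
exact Hab.
Qed.

Lemma Cseries_dominated (a : nat -> C) (b : nat -> R) :
  ex_series b -> (forall n, Cmod (a n) <= b n)%R -> exists l : C, Cseries a l.
Proof.
intros Hb Hab.
refine (ex_series_le (V := C_CompleteNormedModule) a b _ Hb).
exact Hab.
Qed.

Lemma Cseries_psum_cols (g : nat -> nat -> C) (c : nat -> C) (m : nat) :
  (forall j, Cseries (fun i => g i j) (c j)) ->
  Cseries (fun i => psum (g i) m) (psum c m).
Proof.
intros Hc. induction m as [|m IH]; simpl.
- apply (Cseries_ext (fun i => 0 * g i 0%nat)); [intros n; ring|].
  assert (H := Cseries_scal 0 _ _ (Hc 0%nat)).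
  rewrite Cmult_0_l in H. exact H.
- now apply Cseries_plus.
Qed.

Lemma psum_sum_n (a : nat -> C) (n : nat) : psum a (S n) = sum_n a n.
Proof.
induction n as [|n IH].
- rewrite sum_O. simpl. ring.
- rewrite sum_Sn, <- IH. reflexivity.
Qed.

(** The bound [u i * v j] controls the tail of every row uniformly: the sum of the
    first [n + 1] columns misses the sum of the rows by at most
    [U * (V - sum_n v n)]. *)
Lemma Cseries_fubini (g : nat -> nat -> C) (u v : nat -> R) (r c : nat -> C) :
  ex_series u -> ex_series v ->
  (forall i j, Cmod (g i j) <= u i * v j)%R ->
  (forall i, Cseries (g i) (r i)) ->
  (forall j, Cseries (fun i => g i j) (c j)) ->
  exists T : C, Cseries r T /\ Cseries c T.
Proof.
intros HU%Series_correct HV%Series_correct Hg Hr Hc.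
set (U := Series u) in HU. set (V := Series v) in HV.
destruct (Cseries_dominated r (fun i => u i * V)%R) as [T HT].
{ exists (U * V)%R. now apply is_series_scal_r. }
{ intros i. apply (Cseries_Cmod_le (g i) _ (fun j => u i * v j)%R); auto.
  now apply (is_series_scal_l (u i) v). }
exists T. split; [exact HT|].
assert (Htail : forall n, (Cmod (T - sum_n c n) <= U * (V - sum_n v n))%R).
{ intros n. rewrite <- psum_sum_n.
  apply (Cseries_Cmod_le (fun i => r i - psum (g i) (S n)) _
           (fun i => u i * (V - sum_n v n))%R).
  - apply Cseries_minus; [exact HT|]. now apply Cseries_psum_cols.
  - now apply is_series_scal_r.
  - intros i.
    apply (Cseries_Cmod_le (fun k => g i (S n + k)%nat) _
             (fun k => u i * v (S n + k)%nat)%R); auto.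
    + apply (Cseries_drop (g i)), Hr.
    + apply (is_series_scal_l (u i) (fun k => v (S n + k)%nat)).
      apply is_series_incr_n; [lia|].
      match goal with |- is_series _ ?x => replace x with V; [exact HV|] end.
      change (@eq R V (V - sum_n v n + sum_n v n)%R). ring. }
apply (filterlim_locally_ball_norm (U := C_NormedModule)).
intros eps.
assert (Hl : is_lim_seq (fun n => U * (V - sum_n v n))%R 0).
{ replace (Finite 0) with (Rbar_mult U (V - V)%R)
    by (simpl; f_equal; ring).
  apply is_lim_seq_scal_l.
  apply is_lim_seq_minus'; [apply is_lim_seq_const|exact HV]. }
apply is_lim_seq_spec in Hl. destruct (Hl eps) as [N HN].
exists N. intros n Hn. specialize (HN n Hn).
change (Cmod (minus (sum_n c n) T) < eps)%R.
replace (minus (sum_n c n) T) with (- (T - sum_n c n)) by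
  (change (minus (sum_n c n) T) with (sum_n c n - T); ring).
rewrite Cmod_opp.
eapply Rle_lt_trans; [apply Htail|].
eapply Rle_lt_trans; [|exact HN].
rewrite Rminus_0_r. apply Rle_abs.
Qed.

(** Convergence of [a] itself is assumed, so it is enough to follow the partial sums
    of even length. *)
Lemma Cseries_even_odd (a : nat -> C) (l l0 l1 : C) :
  Cseries a l -> Cseries (fun k => a (2 * k)%nat) l0 ->
  Cseries (fun k => a (2 * k + 1)%nat) l1 -> l = l0 + l1.
Proof.
intros H H0 H1.
apply (filterlim_locally_unique (V := C_NormedModule) (F := eventually)
        (fun n => sum_n a (2 * n + 1)%nat)).
- apply (filterlim_comp _ _ _ (fun n => 2 * n + 1)%nat (sum_n a) _ eventually);
    [|exact H].
  intros P [N HN]. exists N. intros n Hn. apply HN. lia.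
- apply (filterlim_ext (sum_n (fun k => a (2 * k)%nat + a (2 * k + 1)%nat))).
  2: exact (Cseries_plus _ _ _ _ H0 H1).
  intros n. induction n as [|n IH].
  + rewrite sum_O. change (2 * 0 + 1)%nat with 1%nat.
    now rewrite sum_Sn, sum_O.
  + rewrite sum_Sn, IH.
    replace (2 * S n + 1)%nat with (S (S (2 * n + 1))) by lia.
    rewrite 2 sum_Sn, <- plus_assoc.
    f_equal.
    now replace (2 * S n)%nat with (S (2 * n + 1)) by lia.
Qed.

(** * Folding a reflected series *)

(** The value at [i - m] of the extension of [a] to all integers for which
    [-1 - k] is the mirror image of [k] and values at mirror images add up to [- c].
    With [a k] the value of a function at the odd number [2k+1], this is
    reflection through 0: oddness for [c = 0], and the symmetry of [(coth - 1)/2]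
    for [c = 1]. *)
Definition reflect (c : C) (a : nat -> C) (m i : nat) : C :=
  if le_dec m i then a (i - m)%nat else - c - a (m - 1 - i)%nat.

(** In terms of [x = 2i+1+d], [y = 2m+d] and the function [f (2k+1) = a k] on odd
    numbers, extended by reflection, this evaluates [sum x (f (x + y) + f (x - y))]
    over the positive [x] with [x + y] odd.  Shifting [x] changes the weights into [p - y] for [p > y] and [p + y] for
    [p > -y]; they add up to [2p] above [y], and folding the part [-y < p <= y]
    onto positive [p] gives [(p + y) - (y - p) = 2p] again.  The reflection constant
    contributes [- c] times the sum of the [x < y].  The case [d = 0] is used along
    the rows of the array [cross], [d = 1] along its columns. *)
Lemma Cseries_reflect (c : C) (a : nat -> C) (L A : C) (m d : nat) :
  (d <= 1)%nat -> Cseries a L ->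
  Cseries (fun k => INR (2 * k + 1) * a k) A ->
  Cseries (fun i => INR (2 * i + 1 + d) * (a (m + d + i)%nat + reflect c a m i))
          (2 * A - c * (INR m * INR (m + d))).
Proof.
intros Hd HL HA.
set (b := fun k => INR (2 * k + 1) * a k - INR (2 * m + d) * a k).
assert (Hb : Cseries b (A - INR (2 * m + d) * L)).
{ apply Cseries_minus; [exact HA|]. now apply Cseries_scal. }
assert (Hright := Cseries_drop b _ (m + d) Hb).
set (e := fun i => INR (2 * i + 1 + d) * reflect c a m i).
assert (Hleft : Cseries e (psum e m + (A + INR (2 * m + d) * L))).
{ apply Cseries_undrop.
  apply (Cseries_ext (fun k => INR (2 * k + 1) * a k + INR (2 * m + d) * a k)).
  - intros k. unfold e, reflect. destruct (le_dec m (m + k)); [|lia].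
    replace (m + k - m)%nat with k by lia. push_INR. ring.
  - apply Cseries_plus; [exact HA|]. now apply Cseries_scal. }
(* For [d = 1] the extra term has weight [(2m+1) - (2m+1) = 0]. *)
assert (Hbm : psum b (m + d) = psum b m).
{ destruct d as [|[|d]]; [now rewrite Nat.add_0_r| |lia].
  rewrite Nat.add_1_r. simpl psum. unfold b at 2. push_INR. ring. }
assert (Hsq : forall n, psum (fun i => RtoC (INR (2 * i + 1 + d))) n
                        = INR n * INR (n + d)).
{ induction n as [|n IH]; [simpl; ring|].
  rewrite psum_S, IH. push_INR. ring. }
(* The terms with [p < y] cancel in pairs once one of the sums is reversed. *)
assert (Hfin : psum e m - psum b m = - c * (INR m * INR (m + d))).
{ rewrite <- (psum_rev e), <- Hsq, <- (psum_rev (fun i => RtoC (INR (2 * i + 1 + d)))).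
  clear - b e.
  assert (H : forall n, (n <= m)%nat ->
    psum (fun k => e (m - 1 - k)%nat) n - psum b n
    = - c * psum (fun k => RtoC (INR (2 * (m - 1 - k) + 1 + d))) n); [|now apply H].
  induction n as [|n IH]; intros Hn; [simpl; ring|].
  rewrite 3 psum_S.
  transitivity (psum (fun k => e (m - 1 - k)%nat) n - psum b n
                + (e (m - 1 - n)%nat - b n)); [ring|].
  rewrite IH by lia.
  unfold e, b, reflect. destruct (le_dec m (m - 1 - n)); [lia|].
  replace (m - 1 - (m - 1 - n))%nat with n by lia.
  replace (INR (2 * m + d))
    with (INR (2 * (m - 1 - n) + 1 + d) + INR (2 * n + 1))%R
    by (rewrite <- plus_INR; f_equal; lia).
  rewrite RtoC_plus. ring. }
rewrite Hbm in Hright.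
replace (2 * A - c * (INR m * INR (m + d)))
  with (A - INR (2 * m + d) * L - psum b m
        + (psum e m + (A + INR (2 * m + d) * L))).
2:{ transitivity (2 * A + (psum e m - psum b m)); [ring|]. rewrite Hfin. ring. }
apply (Cseries_ext (fun i => b (m + d + i)%nat + e i)).
- intros i. unfold b, e. push_INR. ring.
- now apply Cseries_plus.
Qed.

(** * Bounds for powers of q *)

Lemma one_minus_bound (x : C) (r : R) :
  (Cmod x <= r)%R -> (r < 1)%R ->
  1 - x <> 0 /\ (Cmod (/ (1 - x)) <= / (1 - r))%R.
Proof.
intros Hx Hr.
assert (H : (1 - r <= Cmod (1 - x))%R).
{ assert (H := Cmod_triangle (1 - x) x).
  replace (1 - x + x) with (RtoC 1) in H by ring. rewrite Cmod_1 in H. lra. }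
assert (H0 : 1 - x <> 0).
{ intros E. rewrite E, Cmod_0 in H. lra. }
split; [exact H0|].
rewrite Cmod_inv by exact H0. apply Rinv_le_contravar; lra.
Qed.

Lemma pow_decr (r : R) (m n : nat) :
  (0 <= r <= 1)%R -> (m <= n)%nat -> (r ^ n <= r ^ m)%R.
Proof.
intros Hr H. induction H as [|n H IH]; [lra|]. simpl.
assert (0 <= r ^ n)%R by (apply pow_le; lra). nra.
Qed.

Lemma Cmod_pow_le (q : C) (r : R) (m n : nat) :
  (Cmod q <= r)%R -> (r < 1)%R -> (m <= n)%nat -> (Cmod (q ^ n) <= r ^ m)%R.
Proof.
intros Hq Hr H. rewrite Cmod_pow.
assert (H0 := Cmod_ge_0 q).
eapply Rle_trans; [apply pow_incr; split; eassumption|].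
apply pow_decr; [lra|exact H].
Qed.

Lemma exists_ratio_bound (q : C) :
  (Cmod q < 1)%R -> exists r : R, (0 < r < 1)%R /\ (Cmod q <= r)%R.
Proof.
intros Hq. assert (H0 := Cmod_ge_0 q).
exists ((1 + Cmod q) / 2)%R. lra.
Qed.

Lemma one_minus_pow_bound (q : C) (r : R) (n : nat) :
  (Cmod q <= r)%R -> (r < 1)%R -> (1 <= n)%nat ->
  1 - q ^ n <> 0 /\ (Cmod (/ (1 - q ^ n)) <= / (1 - r))%R.
Proof.
intros Hq Hr Hn. apply one_minus_bound; [|exact Hr].
rewrite <- (pow_1 r). now apply Cmod_pow_le.
Qed.

Lemma one_minus_pow_neq0 (q : C) (n : nat) :
  (Cmod q < 1)%R -> (1 <= n)%nat -> 1 - q ^ n <> 0.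
Proof.
intros Hq Hn. now apply (one_minus_pow_bound q (Cmod q) n (Rle_refl _)).
Qed.

Lemma Cmod_pow_div_le (q : C) (r : R) (k m n : nat) :
  (Cmod q <= r)%R -> (r < 1)%R -> (k <= m)%nat -> (1 <= n)%nat ->
  (Cmod (q ^ m / (1 - q ^ n)) <= r ^ k * / (1 - r))%R.
Proof.
intros Hq Hr Hk Hn. unfold Cdiv. rewrite Cmod_mult.
apply Rmult_le_compat; [apply Cmod_ge_0|apply Cmod_ge_0| |].
- now apply Cmod_pow_le.
- now apply one_minus_pow_bound.
Qed.

Lemma ex_series_cubes_geom (r : R) :
  (0 < r < 1)%R -> ex_series (fun k => INR (k + 1) ^ 3 * r ^ k)%R.
Proof.
intros Hr.
assert (Hpos : forall k, (0 < INR (k + 1))%R) by (intros k; apply lt_0_INR; lia).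
apply ex_series_Rabs, (ex_series_DAlembert _ r); [lra| |].
- intros k. specialize (Hpos k).
  apply Rmult_integral_contrapositive_currified; apply pow_nonzero; lra.
- apply (is_lim_seq_ext (fun k => (1 + / INR (k + 1)) * ((1 + / INR (k + 1))
           * ((1 + / INR (k + 1)) * r)))%R).
  + intros k. specialize (Hpos k).
    assert (0 < r ^ k)%R by (apply pow_lt; lra).
    replace (INR (S k + 1)) with (INR (k + 1) + 1)%R
      by (rewrite <- S_INR; f_equal; lia).
    replace (r ^ S k)%R with (r * r ^ k)%R by reflexivity. rewrite Rabs_pos_eq.
    * field. lra.
    * apply Rmult_le_pos.
      -- apply Rmult_le_pos; [apply pow_le; lra|nra].
      -- apply Rlt_le, Rinv_0_lt_compat, Rmult_lt_0_compat; [apply pow_lt|]; lra.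
  + assert (H1 : is_lim_seq (fun k => 1 + / INR (k + 1))%R 1).
    { replace (Finite 1) with (Finite (1 + 0)) by (f_equal; ring).
      apply is_lim_seq_plus'; [apply is_lim_seq_const|].
      replace (Finite 0) with (Rbar_inv p_infty) by reflexivity.
      apply is_lim_seq_inv; [|discriminate].
      apply (is_lim_seq_incr_n INR 1), is_lim_seq_INR. }
    replace (Finite r) with (Finite (1 * (1 * (1 * r)))) by (f_equal; ring).
    repeat (apply is_lim_seq_mult'; [exact H1|]). apply is_lim_seq_const.
Qed.

Lemma Cseries_cubes_geom_dominated (r M : R) (a : nat -> C) :
  (0 < r < 1)%R -> (forall k, Cmod (a k) <= M * (INR (k + 1) ^ 3 * r ^ k))%R ->
  exists l : C, Cseries a l.
Proof.
intros Hr Ha.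
apply (Cseries_dominated _ _ (ex_series_scal_l M _ (ex_series_cubes_geom r Hr)) Ha).
Qed.

(** * The second identity *)

Lemma Cseries_pow_geom_ex (y : C) (p : nat) :
  (Cmod y < 1)%R -> (p <= 3)%nat ->
  exists l : C, Cseries (fun k => INR (k + 1) ^ p * y ^ k) l.
Proof.
intros Hy Hp. destruct (exists_ratio_bound y Hy) as (r & Hr & Hyr).
apply (Cseries_cubes_geom_dominated r 1); [exact Hr|].
intros k. rewrite Cmod_mult, Cmod_pow, Cmod_R, Rmult_1_l.
assert (H1 : (1 <= INR (k + 1))%R) by (apply (le_INR 1); lia).
rewrite Rabs_pos_eq by lra.
apply Rmult_le_compat; [apply pow_le; lra|apply Cmod_ge_0| |].
- now apply Rle_pow.
- apply Cmod_pow_le; [lra|lra|lia].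
Qed.

(** With [Ap = sum (k+1)^p y^k], removing the first term and expanding
    [((k+1) + 1)^p] gives [Ap - 1 = y (Ap + ...)], where the dots involve only lower
    exponents; solving for [p = 0, 1, 2, 3] in turn yields [A0] and [A3]. *)
Lemma Cseries_cubes_geom (y : C) :
  (Cmod y < 1)%R ->
  Cseries (fun k => y ^ k) (/ (1 - y)) /\
  Cseries (fun k => INR (k + 1) ^ 3 * y ^ (k + 1))
    (6 * (y ^ 2 / (1 - y) ^ 4) + y / (1 - y) ^ 2).
Proof.
intros Hy.
assert (Hy1 : 1 - y <> 0).
{ rewrite <- (Cpow_1_r y). apply one_minus_pow_neq0; [exact Hy|lia]. }
destruct (Cseries_pow_geom_ex y 0 Hy ltac:(lia)) as [A0 H0].
destruct (Cseries_pow_geom_ex y 1 Hy ltac:(lia)) as [A1 H1].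
destruct (Cseries_pow_geom_ex y 2 Hy ltac:(lia)) as [A2 H2].
destruct (Cseries_pow_geom_ex y 3 Hy ltac:(lia)) as [A3 H3].
assert (E0 : A0 - 1 = y * A0).
{ apply (Cseries_unique (fun k => INR (S k + 1) ^ 0 * y ^ S k)).
  - replace (RtoC 1) with (INR (0 + 1) ^ 0 * y ^ 0) at 1 by (simpl; ring).
    exact (Cseries_shift _ _ H0).
  - eapply Cseries_ext; [|apply (Cseries_scal y _ _ H0)].
    intros k. rewrite (Cpow_S y k). push_INR. ring. }
assert (E1 : A1 - 1 = y * (A1 + A0)).
{ apply (Cseries_unique (fun k => INR (S k + 1) ^ 1 * y ^ S k)).
  - replace (RtoC 1) with (INR (0 + 1) ^ 1 * y ^ 0) at 1 by (simpl; ring).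
    exact (Cseries_shift _ _ H1).
  - eapply Cseries_ext; [|apply (Cseries_scal y _ _ (Cseries_plus _ _ _ _ H1 H0))].
    intros k. rewrite (Cpow_S y k). push_INR. ring. }
assert (E2 : A2 - 1 = y * (A2 + (2 * A1 + A0))).
{ apply (Cseries_unique (fun k => INR (S k + 1) ^ 2 * y ^ S k)).
  - replace (RtoC 1) with (INR (0 + 1) ^ 2 * y ^ 0) at 1 by (simpl; ring).
    exact (Cseries_shift _ _ H2).
  - eapply Cseries_ext; [|apply (Cseries_scal y _ _ (Cseries_plus _ _ _ _ H2
      (Cseries_plus _ _ _ _ (Cseries_scal 2 _ _ H1) H0)))].
    intros k. rewrite (Cpow_S y k). push_INR. ring. }
assert (E3 : A3 - 1 = y * (A3 + (3 * A2 + (3 * A1 + A0)))).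
{ apply (Cseries_unique (fun k => INR (S k + 1) ^ 3 * y ^ S k)).
  - replace (RtoC 1) with (INR (0 + 1) ^ 3 * y ^ 0) at 1 by (simpl; ring).
    exact (Cseries_shift _ _ H3).
  - eapply Cseries_ext; [|apply (Cseries_scal y _ _ (Cseries_plus _ _ _ _ H3
      (Cseries_plus _ _ _ _ (Cseries_scal 3 _ _ H2)
        (Cseries_plus _ _ _ _ (Cseries_scal 3 _ _ H1) H0))))].
    intros k. rewrite (Cpow_S y k). push_INR. ring. }
assert (solve : forall u w : C, u - 1 = y * (u + w) -> u = (1 + y * w) / (1 - y)).
{ intros u w E.
  transitivity ((u - 1 - y * u + 1) / (1 - y)); [field; exact Hy1|].
  rewrite E. field. exact Hy1. }
assert (F0 : A0 = / (1 - y)).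
{ rewrite (solve A0 0); [field; exact Hy1|]. rewrite E0. ring. }
apply solve in E1. apply solve in E2. apply solve in E3.
rewrite E2, E1, F0 in E3. clear E0 E1 E2. split.
- rewrite F0 in H0. revert H0. apply Cseries_ext. intros k. simpl. ring.
- replace (6 * (y ^ 2 / (1 - y) ^ 4) + y / (1 - y) ^ 2) with (y * A3).
  + eapply Cseries_ext; [|apply (Cseries_scal y _ _ H3)].
    intros k. rewrite Nat.add_1_r, (Cpow_S y k). push_INR. ring.
  + rewrite E3. field. exact Hy1.
Qed.

(** Rows and columns of the array [n^3 (q^m)^n] for [m = 2i+1] and [n = k+1]; the
    product bound comes from [m n >= i + k]. *)
Lemma lambert_cubes (q : C) :
  (Cmod q < 1)%R ->
  exists T : C,
    Cseries (fun i => 6 * ((q ^ (2 * i + 1)) ^ 2 / (1 - q ^ (2 * i + 1)) ^ 4)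
                      + q ^ (2 * i + 1) / (1 - q ^ (2 * i + 1)) ^ 2) T /\
    Cseries (fun k => INR (k + 1) ^ 3 * (q ^ (k + 1) / (1 - q ^ (2 * (k + 1))))) T.
Proof.
intros Hq. destruct (exists_ratio_bound q Hq) as (r & Hr & Hqr).
apply (Cseries_fubini (fun i k => INR (k + 1) ^ 3 * (q ^ (2 * i + 1)) ^ (k + 1))
         (fun i => r ^ i)%R (fun k => INR (k + 1) ^ 3 * r ^ k)%R).
- apply ex_series_geom. rewrite Rabs_pos_eq; lra.
- now apply ex_series_cubes_geom.
- intros i k.
  rewrite Cmod_mult, Cmod_pow, Cmod_R, Rabs_pos_eq by apply pos_INR.
  rewrite <- Cpow_mult_r.
  apply Rle_trans with (INR (k + 1) ^ 3 * r ^ (i + k))%R.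
  + apply Rmult_le_compat_l; [apply pow_le, pos_INR|].
    apply Cmod_pow_le; [lra|lra|nia].
  + rewrite pow_add. lra.
- intros i. apply Cseries_cubes_geom.
  eapply Rle_lt_trans; [apply (Cmod_pow_le q r 1); [lra|lra|lia]|]. lra.
- intros k. apply Cseries_scal.
  assert (Hy : (Cmod (q ^ (2 * (k + 1))) < 1)%R).
  { eapply Rle_lt_trans; [apply (Cmod_pow_le q r 1); [lra|lra|lia]|]. lra. }
  eapply Cseries_ext;
    [|apply (Cseries_scal (q ^ (k + 1)) _ _ (proj1 (Cseries_cubes_geom _ Hy)))].
  intros i. simpl. rewrite <- !Cpow_mult_r, <- Cpow_add_r. f_equal. lia.
Qed.

(** * The first identity *)

(** The [h n] of the introduction: half of [csch (n t)] for [q = exp (-t)]. *)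
Definition csch (q : C) (n : nat) : C := q ^ n / (1 - q ^ (2 * n)).

(** The [g n] of the introduction: half of [coth (n t) - 1] for [q = exp (-t)]. *)
Definition coth1 (q : C) (n : nat) : C := q ^ (2 * n) / (1 - q ^ (2 * n)).

(* Proves a rational identity between values at [x], [y] and [x + y]. *)
Ltac solve_addition q x y Hq :=
  unfold csch, coth1;
  let H1 := fresh in let H2 := fresh in let H3 := fresh in
  assert (H1 := one_minus_pow_neq0 q (2 * x) Hq ltac:(lia));
  assert (H2 := one_minus_pow_neq0 q (2 * y) Hq ltac:(lia));
  assert (H3 := one_minus_pow_neq0 q (2 * (x + y)) Hq ltac:(lia));
  revert H1 H2 H3;
  replace (2 * (x + y))%nat with (x + x + (y + y))%nat by lia;
  replace (2 * x)%nat with (x + x)%nat by lia;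
  replace (2 * y)%nat with (y + y)%nat by lia;
  rewrite !Cpow_add_r; intros H1 H2 H3; field; auto.

(** The subtraction formula [coth x - coth y = sinh (y - x) / (sinh x sinh y)]. *)
Lemma csch_mul_sub (q : C) (x s : nat) :
  (Cmod q < 1)%R -> (1 <= x)%nat -> (1 <= s)%nat ->
  csch q x * csch q (x + s) = csch q s * (coth1 q x - coth1 q (x + s)).
Proof. intros Hq Hx Hs. solve_addition q x s Hq. Qed.

(** The addition formula [coth x + coth y = sinh (x + y) / (sinh x sinh y)]. *)
Lemma csch_mul_add (q : C) (x y : nat) :
  (Cmod q < 1)%R -> (1 <= x)%nat -> (1 <= y)%nat ->
  csch q x * csch q y = csch q (x + y) * (1 + coth1 q x + coth1 q y).
Proof. intros Hq Hx Hy. solve_addition q x y Hq. Qed.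

(** With [x = 2(j+1)] and [s = 2i+1], this is
    [h x (h (x + s) + h (s - x)) = h s (2 g x - g (x + s) - g (x - s))], the two
    reflections giving a meaning to the values at negative arguments. *)
Lemma csch_mul_reflect (q : C) (j i : nat) :
  (Cmod q < 1)%R ->
  csch q (2 * (j + 1)) * (csch q (2 * (j + 1 + 0 + i) + 1)
     + reflect 0 (fun k => csch q (2 * k + 1)) (j + 1) i)
  = csch q (2 * i + 1) * (2 * coth1 q (2 * (j + 1))
     - (coth1 q (2 * (i + 1 + j) + 1)
        + reflect 1 (fun k => coth1 q (2 * k + 1)) i j)).
Proof.
intros Hq.
assert (Hsum := csch_mul_sub q (2 * (j + 1)) (2 * i + 1) Hq ltac:(lia) ltac:(lia)).
replace (2 * (j + 1) + (2 * i + 1))%nat with (2 * (i + 1 + j) + 1)%nat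
  in Hsum by lia.
replace (2 * (j + 1 + 0 + i) + 1)%nat with (2 * (i + 1 + j) + 1)%nat by lia.
rewrite Cmult_plus_distr_l, Hsum. unfold reflect.
destruct (le_dec (j + 1) i) as [Hji|Hji], (le_dec i j) as [Hij|Hij]; try lia.
- assert (Hdiff := csch_mul_add q (2 * (j + 1)) (2 * (i - (j + 1)) + 1) Hq
                     ltac:(lia) ltac:(lia)).
  replace (2 * (j + 1) + (2 * (i - (j + 1)) + 1))%nat with (2 * i + 1)%nat
    in Hdiff by lia.
  rewrite Hdiff.
  replace (i - (j + 1))%nat with (i - 1 - j)%nat by lia. ring.
- assert (Hdiff := csch_mul_sub q (2 * (j - i) + 1) (2 * i + 1) Hq
                     ltac:(lia) ltac:(lia)).
  replace (2 * (j - i) + 1 + (2 * i + 1))%nat with (2 * (j + 1))%nat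
    in Hdiff by lia.
  replace (j + 1 - 1 - i)%nat with (j - i)%nat by lia.
  match goal with |- _ + ?x = _ =>
    replace x with (- (csch q (2 * (j - i) + 1) * csch q (2 * (j + 1)))) by ring end.
  rewrite Hdiff. ring.
Qed.

(** The term [j s h(2j) (h(2j+s) + h(s-2j))] for [j + 1] in place of [j] and
    [s = 2i+1]; it is grouped, and the index written [j + 1 + 0 + i], so as to fit
    [Cseries_reflect] along a row. *)
Definition cross (q : C) (j i : nat) : C :=
  INR (j + 1) * csch q (2 * (j + 1)) *
  (INR (2 * i + 1) * (csch q (2 * (j + 1 + 0 + i) + 1)
     + reflect 0 (fun k => csch q (2 * k + 1)) (j + 1) i)).

Lemma INR_le_cube (n k c : nat) :
  (n <= c * (k + 1))%nat -> (INR n <= INR c * INR (k + 1) ^ 3)%R.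
Proof.
intros H.
apply Rle_trans with (INR (c * (k + 1))); [now apply le_INR|].
rewrite mult_INR. apply Rmult_le_compat_l; [apply pos_INR|].
assert (1 <= INR (k + 1))%R by (apply (le_INR 1); lia). simpl. nra.
Qed.

Lemma Cmod_scaled_le (n k c : nat) (z : C) (r M : R) :
  (0 <= r)%R -> (n <= c * (k + 1))%nat -> (Cmod z <= r ^ k * M)%R ->
  (Cmod (INR n * z) <= INR c * M * (INR (k + 1) ^ 3 * r ^ k))%R.
Proof.
intros Hr Hn Hz. rewrite Cmod_mult, Cmod_R, Rabs_pos_eq by apply pos_INR.
replace (INR c * M * (INR (k + 1) ^ 3 * r ^ k))%R
  with (INR c * INR (k + 1) ^ 3 * (r ^ k * M))%R by ring.
apply Rmult_le_compat; [apply pos_INR|apply Cmod_ge_0| |exact Hz].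
now apply INR_le_cube.
Qed.

(** The exponents of [q] in [h(2j) h(2j+s)] and [h(2j) h(|s-2j|)] are at least
    [max (s, 2j)], hence at least the sum of the two indices: this is what makes the
    bound a product. *)
Lemma cross_bound (q : C) (r : R) (j i : nat) :
  (0 < r < 1)%R -> (Cmod q <= r)%R ->
  (Cmod (cross q j i)
   <= (INR (j + 1) ^ 3 * r ^ j)
      * (4 * / (1 - r) * / (1 - r) * (INR (i + 1) ^ 3 * r ^ i)))%R.
Proof.
intros Hr Hq.
assert (Hterm : forall n, (1 <= n)%nat -> (i + j <= 2 * (j + 1) + n)%nat ->
  (Cmod (csch q (2 * (j + 1)) * csch q n)
   <= r ^ i * (r ^ j * / (1 - r) * / (1 - r)))%R).
{ intros n Hn Hij. unfold csch.
  replace (q ^ (2 * (j + 1)) / (1 - q ^ (2 * (2 * (j + 1))))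
           * (q ^ n / (1 - q ^ (2 * n))))
    with (q ^ (2 * (j + 1) + n) * (/ (1 - q ^ (2 * (2 * (j + 1))))
                                   * / (1 - q ^ (2 * n))))
    by (rewrite Cpow_add_r; unfold Cdiv; ring).
  rewrite !Cmod_mult.
  replace (r ^ i * (r ^ j * / (1 - r) * / (1 - r)))%R
    with (r ^ (i + j) * (/ (1 - r) * / (1 - r)))%R by (rewrite pow_add; ring).
  apply Rmult_le_compat; [apply Cmod_ge_0| |apply Cmod_pow_le; [lra|lra|lia]|].
  - apply Rmult_le_pos; apply Cmod_ge_0.
  - apply Rmult_le_compat; try apply Cmod_ge_0;
      (apply one_minus_pow_bound; [lra|lra|lia]). }
assert (Hsum : (Cmod (csch q (2 * (j + 1)) * (csch q (2 * (j + 1 + 0 + i) + 1)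
     + reflect 0 (fun k => csch q (2 * k + 1)) (j + 1) i))
   <= r ^ i * (2 * (r ^ j * / (1 - r) * / (1 - r))))%R).
{ rewrite Cmult_plus_distr_l. eapply Rle_trans; [apply Cmod_triangle|].
  replace (r ^ i * (2 * (r ^ j * / (1 - r) * / (1 - r))))%R
    with (r ^ i * (r ^ j * / (1 - r) * / (1 - r))
          + r ^ i * (r ^ j * / (1 - r) * / (1 - r)))%R by ring.
  apply Rplus_le_compat; [apply Hterm; lia|].
  unfold reflect. destruct (le_dec (j + 1) i); [apply Hterm; lia|].
  match goal with |- (Cmod (?a * (_ - ?b))%C <= _)%R =>
    replace (a * (- 0 - b)) with (- (a * b)) by ring end.
  rewrite Cmod_opp. apply Hterm; lia. }
assert (Hi := Cmod_scaled_le (2 * i + 1) i 2 _ r _ (Rlt_le _ _ (proj1 Hr))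
                ltac:(lia) Hsum).
unfold cross.
match goal with |- (Cmod (?a * ?b * (?c * ?d))%C <= _)%R =>
  replace (a * b * (c * d)) with (a * (c * (b * d))) by ring end.
rewrite Cmod_mult, Cmod_R, Rabs_pos_eq by apply pos_INR.
assert (Hj := INR_le_cube (j + 1) j 1 ltac:(lia)). rewrite INR_1, Rmult_1_l in Hj.
eapply Rle_trans;
  [apply Rmult_le_compat; [apply pos_INR|apply Cmod_ge_0|exact Hj|exact Hi]|].
simpl (INR 2). right. ring.
Qed.

Lemma lambert_convolution (q : C) :
  (Cmod q < 1)%R ->
  exists S1 S2 S3 : C,
    Cseries (fun k => INR (k + 1) * (q ^ (2 * (k + 1)) / (1 + q ^ (2 * (k + 1))))) S1 /\
    Cseries (fun k => INR (2 * k + 1) * csch q (2 * k + 1)) S2 /\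
    Cseries (fun k => B3 (k + 1) / 3 * csch q (2 * k + 1)) S3 /\
    S1 * S2 = S3.
Proof.
intros Hq. destruct (exists_ratio_bound q Hq) as (r & Hr & Hqr).
assert (Hr0 : (0 <= r)%R) by lra.
assert (Hex : forall (w : nat -> nat) (c : nat) (z : nat -> C),
  (forall k, w k <= c * (k + 1))%nat ->
  (forall k, Cmod (z k) <= r ^ k * / (1 - r))%R ->
  exists l : C, Cseries (fun k => INR (w k) * z k) l).
{ intros w c z Hw Hz.
  apply (Cseries_cubes_geom_dominated r (INR c * / (1 - r))); [exact Hr|].
  intros k. now apply Cmod_scaled_le. }
destruct (Hex (fun k => k + 1)%nat 1%nat (fun k => csch q (2 * (k + 1)))) as [D HD];
  [intros k; lia|intros k; apply Cmod_pow_div_le; lra || lia|].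
destruct (Hex (fun k => k + 1)%nat 1%nat (fun k => coth1 q (2 * (k + 1)))) as [G0 HG0];
  [intros k; lia|intros k; apply Cmod_pow_div_le; lra || lia|].
destruct (Hex (fun k => k + 1)%nat 1%nat (fun k => coth1 q (k + 1))) as [Z HZ];
  [intros k; lia|intros k; apply Cmod_pow_div_le; lra || lia|].
destruct (Hex (fun k => 2 * k + 1)%nat 2%nat (fun k => csch q (2 * k + 1))) as [S2 HS2];
  [intros k; lia|intros k; apply Cmod_pow_div_le; lra || lia|].
destruct (Hex (fun k => 1)%nat 1%nat (fun k => csch q (2 * k + 1))) as [H HH];
  [intros k; lia|intros k; apply Cmod_pow_div_le; lra || lia|].
destruct (Hex (fun k => 2 * k + 1)%nat 2%nat (fun k => coth1 q (2 * k + 1))) as [G1 HG1];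
  [intros k; lia|intros k; apply Cmod_pow_div_le; lra || lia|].
destruct (Hex (fun k => 1)%nat 1%nat (fun k => coth1 q (2 * k + 1))) as [G HG];
  [intros k; lia|intros k; apply Cmod_pow_div_le; lra || lia|].
cbv beta in *.
apply (Cseries_ext _ (fun k => csch q (2 * k + 1))) in HH;
  [|intros k; simpl; ring].
apply (Cseries_ext _ (fun k => coth1 q (2 * k + 1))) in HG;
  [|intros k; simpl; ring].
assert (HZsplit : Z = G1 + 2 * G0).
{ apply (Cseries_even_odd _ _ _ _ HZ); [exact HG1|].
  eapply Cseries_ext; [|apply (Cseries_scal 2 _ _ HG0)].
  intros k. replace (2 * k + 1 + 1)%nat with (2 * (k + 1))%nat by lia.
  push_INR. ring. }
assert (Hplus : forall k, 1 + q ^ (2 * (k + 1)) <> 0).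
{ intros k. replace (1 + q ^ (2 * (k + 1))) with (1 - - q ^ (2 * (k + 1))) by ring.
  apply (one_minus_bound _ r); [|lra]. rewrite Cmod_opp, <- (pow_1 r).
  apply Cmod_pow_le; lra || lia. }
(* [x/(1-x^2) - x^2/(1-x^2) = x/(1+x)] for [x = q^(2n)]. *)
assert (HS1 : Cseries (fun k => INR (k + 1)
                * (q ^ (2 * (k + 1)) / (1 + q ^ (2 * (k + 1))))) (D - G0)).
{ eapply Cseries_ext; [|apply (Cseries_minus _ _ _ _ HD HG0)].
  intros k. cbv beta. unfold csch, coth1.
  assert (H1 := one_minus_pow_neq0 q (2 * (2 * (k + 1))) Hq ltac:(lia)).
  specialize (Hplus k). revert H1 Hplus.
  replace (q ^ (2 * (2 * (k + 1)))) with (q ^ (2 * (k + 1)) * q ^ (2 * (k + 1)))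
    by (rewrite <- Cpow_add_r; f_equal; lia).
  intros H1 H2. field. auto. }
(* [x/(1-x) - 2 x^2/(1-x^2) = x/(1+x)], and [sum 2n g(2n)] is the even part of
   [sum n g(n)]. *)
assert (HS1' : D - G0 = G1).
{ transitivity (Z - 2 * G0); [|rewrite HZsplit; ring].
  apply (Cseries_unique _ _ _ HS1).
  eapply Cseries_ext; [|apply (Cseries_minus _ _ _ _ HZ (Cseries_scal 2 _ _ HG0))].
  intros k. cbv beta. unfold coth1.
  assert (H1 := one_minus_pow_neq0 q (2 * (2 * (k + 1))) Hq ltac:(lia)).
  assert (H2 := one_minus_pow_neq0 q (2 * (k + 1)) Hq ltac:(lia)).
  specialize (Hplus k). revert H1 Hplus.
  replace (q ^ (2 * (2 * (k + 1)))) with (q ^ (2 * (k + 1)) * q ^ (2 * (k + 1)))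
    by (rewrite <- Cpow_add_r; f_equal; lia).
  intros H1 H3. field. auto. }
assert (Hrow : forall j, Cseries (cross q j)
  (INR (j + 1) * csch q (2 * (j + 1)) * (2 * S2))).
{ intros j. apply Cseries_scal.
  assert (E := Cseries_reflect 0 _ _ _ (j + 1) 0 ltac:(lia) HH HS2).
  replace (2 * S2) with (2 * S2 - 0 * (INR (j + 1) * INR (j + 1 + 0))) by ring.
  revert E. apply Cseries_ext. intros i. now rewrite Nat.add_0_r. }
(* [(s^2-1)/8 = i(i+1)/2] and [s i (i+1)/2 = B3 (i+1)] for [s = 2i+1]. *)
assert (Hcol : forall i, Cseries (fun j => cross q j i)
  (INR (2 * i + 1) * csch q (2 * i + 1) * (2 * G0 - G1)
   + 3 * (B3 (i + 1) / 3 * csch q (2 * i + 1)))).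
{ intros i.
  assert (E := Cseries_reflect 1 _ _ _ i 1 ltac:(lia) HG HG1).
  apply (Cseries_scal (/ 2)) in E.
  assert (F := Cseries_scal (INR (2 * i + 1) * csch q (2 * i + 1)) _ _
    (Cseries_minus _ _ _ _ (Cseries_scal 2 _ _ HG0) E)).
  match type of F with is_series _ ?x =>
  replace (INR (2 * i + 1) * csch q (2 * i + 1) * (2 * G0 - G1)
   + 3 * (B3 (i + 1) / 3 * csch q (2 * i + 1))) with x end.
  - revert F. apply Cseries_ext. intros j. cbv beta. unfold cross.
    match goal with |- _ = ?a * ?b * (?c * ?d) =>
      transitivity (a * c * (b * d)); [|ring] end.
    rewrite (csch_mul_reflect q j i Hq). push_INR. field.
  - unfold B3. rewrite ?RtoC_mult, ?RtoC_minus, ?RtoC_div by lra.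
    push_INR. field. }
destruct (Cseries_fubini (cross q) _ _ _ _
  (ex_series_cubes_geom r Hr)
  (ex_series_scal_l (4 * / (1 - r) * / (1 - r))%R _ (ex_series_cubes_geom r Hr))
  (fun j i => cross_bound q r j i Hr Hqr) Hrow Hcol) as [T [HT1 HT2]].
assert (ET : T = 2 * S2 * D).
{ apply (Cseries_unique _ _ _ HT1).
  eapply Cseries_ext; [|apply (Cseries_scal (2 * S2) _ _ HD)].
  intros j. cbv beta. ring. }
exists (D - G0), S2, ((D - G0) * S2).
repeat split; [exact HS1|exact HS2|].
replace ((D - G0) * S2) with (/ 3 * (T - (2 * G0 - G1) * S2)).
- eapply Cseries_ext; [|apply (Cseries_scal (/ 3) _ _
    (Cseries_minus _ _ _ _ HT2 (Cseries_scal (2 * G0 - G1) _ _ HS2)))].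
  intros i. cbv beta. field.
- rewrite ET, <- HS1'. field.
Qed.

(** * Both identities *)

Theorem theorem1p1 : forall q : C, (Cmod q < 1)%R ->
  (exists S1 S2 S3 : C,
     is_sum (fun n => INR n * q ^ (2 * n) / (1 + q ^ (2 * n))) S1 /\
     is_sum (fun n => INR (2 * n - 1) * q ^ (2 * n - 1)
                      / (1 - q ^ (4 * n - 2))) S2 /\
     is_sum (fun n => B3 n / 3 * (q ^ (2 * n - 1) / (1 - q ^ (4 * n - 2)))) S3 /\
     S1 * S2 = S3) /\
  (exists T1 T2 T3 : C,
     is_sum (fun n => q ^ (4 * n - 2) / (1 - q ^ (2 * n - 1)) ^ 4) T1 /\
     is_sum (fun n => q ^ (2 * n - 1) / (1 - q ^ (2 * n - 1)) ^ 2) T2 /\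
     is_sum (fun n => INR n ^ 3 * q ^ n / (1 - q ^ (2 * n))) T3 /\
     6 * T1 + T2 = T3).
Proof.
intros q Hq. split.
- destruct (lambert_convolution q Hq) as (S1 & S2 & S3 & H1 & H2 & H3 & E).
  exists S1, S2, S3. unfold is_sum. repeat split; [| | |exact E].
  + revert H1. apply Cseries_ext. intros k.
    replace (S k) with (k + 1)%nat by lia. unfold Cdiv. ring.
  + revert H2. apply Cseries_ext. intros k. unfold csch.
    replace (2 * S k - 1)%nat with (2 * k + 1)%nat by lia.
    replace (4 * S k - 2)%nat with (2 * (2 * k + 1))%nat by lia.
    unfold Cdiv. ring.
  + revert H3. apply Cseries_ext. intros k. unfold csch.
    replace (2 * S k - 1)%nat with (2 * k + 1)%nat by lia.
    replace (4 * S k - 2)%nat with (2 * (2 * k + 1))%nat by lia.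
    now replace (S k) with (k + 1)%nat by lia.
- destruct (lambert_cubes q Hq) as (T & H12 & H3).
  destruct (exists_ratio_bound q Hq) as (r & Hr & Hqr).
  (* [lambert_cubes] sums the combination [6 T1 + T2]; [T1] is dominated by a
     geometric series, and then [T2] is a difference. *)
  destruct (Cseries_dominated
    (fun i => (q ^ (2 * i + 1)) ^ 2 / (1 - q ^ (2 * i + 1)) ^ 4)
    (fun i => r ^ i * (/ (1 - r)) ^ 4)%R) as [T1 H1].
  + apply ex_series_scal_r, ex_series_geom. rewrite Rabs_pos_eq; lra.
  + intros i.
    assert (H := one_minus_pow_bound q r (2 * i + 1) Hqr ltac:(lra) ltac:(lia)).
    unfold Cdiv. rewrite <- Cpow_inv by apply H.
    rewrite Cmod_mult. rewrite <- Cpow_mult_r.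
    apply Rmult_le_compat; try apply Cmod_ge_0.
    * apply Cmod_pow_le; [lra|lra|lia].
    * rewrite Cmod_pow. apply pow_incr. split; [apply Cmod_ge_0|apply H].
  + exists T1, (T - 6 * T1), T. unfold is_sum. repeat split; [| | |ring].
    * revert H1. apply Cseries_ext. intros i. rewrite <- Cpow_mult_r.
      replace (2 * S i - 1)%nat with (2 * i + 1)%nat by lia.
      now replace (4 * S i - 2)%nat with ((2 * i + 1) * 2)%nat by lia.
    * eapply Cseries_ext;
        [|apply (Cseries_minus _ _ _ _ H12 (Cseries_scal 6 _ _ H1))].
      intros i. cbv beta.
      replace (2 * S i - 1)%nat with (2 * i + 1)%nat by lia. ring.
    * revert H3. apply Cseries_ext. intros k.
      replace (S k) with (k + 1)%nat by lia. unfold Cdiv. ring.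
Qed.
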